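(* Let $\mathcal{F}$ be a filter on a set $X$. The following are equivalent: (1) $\mathcal{F}\in\ker(\mathbb{F}_1^{\bigtriangleup\diamondsuit})$; (2) $\mathcal{F}\in\mathbb{F}_1^{\bigtriangleup\diamondsuit}$ and $\mathcal{F}\vee A\in\ker(\mathbb{F}_1^{\bigtriangleup\diamondsuit})$ for any countable set $A\subseteq X$ meshing with $\mathcal{F}$; (3) if $\bigwedge_{\alpha\in I}(x_n^\alpha)_{n\in\omega}\#\mathcal{F}$ (for a family of sequences in $X$), then there exists a countable $J\subseteq I$ such that $\bigwedge_{\alpha\in J}(x_n^\alpha)_{n\in\omega}\#\mathcal{F}$; (4) if $\bigwedge_{\alpha\in I}(x_n^\alpha)_{n\in\omega}\#\mathcal{F}$, where each sequence $(x_n^\alpha)_{n\in\omega}$ is either free or principal, then there exists a countable $J\subseteq I$ such that $\bigwedge_{\alpha\in J}(x_n^\alpha)_{n\in\omega}\#\mathcal{F}$; (5) if $\{\mathcal{G}_\alpha:\alpha\in I\}\subseteq\mathbb{F}_1^{\bigtriangleup}(X)$ and $\bigwedge_{\alpha\in I}\mathcal{G}_\alpha\#\mathcal{F}$, then there exists a countable $J\subseteq I$ such that $\bigwedge_{\alpha\in J}\mathcal{G}_\alpha\#\mathcal{F}$; (6) $\mathcal{F}\times\mathcal{S}_{|X^\omega|}\in\mathbb{F}_1^{\diamondsuit}$.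
   Context: Filters are proper. A class $\mathbb{J}$ of filters prescribes for each set $X$ a subset $\mathbb{J}(X)$ of the set $\mathbb{F}(X)$ of filters on $X$. $\mathbb{F}_1$ and $\mathbb{F}_\omega$ are the classes of principal filters $A^\uparrow$ ($A\ne\varnothing$) and of countably based filters; a set is identified with its principal filter. A sequence $(x_n)_{n\in\omega}$ is identified with the filter generated by its tails $\{x_n:n\ge k\}$; it is free (principal) if this filter has empty intersection (is a principal filter). $\bigwedge$ denotes infimum (intersection) of filters; $\mathcal{L}\ge\mathcal{F}$ means $\mathcal{F}\subseteq\mathcal{L}$. Two families of sets mesh, $\mathcal{F}\#\mathcal{G}$, if $F\cap G\ne\varnothing$ for all $F\in\mathcal{F}$, $G\in\mathcal{G}$ (and $A\#\mathcal{F}$ means $A\cap F\neq\varnothing$ for all $F\in\mathcal{F}$). If filters mesh, $\mathcal{F}\vee\mathcal{G}$ is the filter generated by the sets $F\cap G$. $\mathcal{F}\times\mathcal{G}$ is the filter generated by the sets $F\times G$. Relations on $\mathbb{F}(X)$: $\mathcal{F}\bigtriangleup\mathcal{H}$ means: if $\mathcal{H}\#\mathcal{F}$ then there is $\mathcal{L}\in\mathbb{F}_\omega(X)$ with $\mathcal{L}\ge\mathcal{F}\vee\mathcal{H}$. $\mathcal{F}\diamondsuit\mathcal{H}$ means: if $\mathcal{H}\#\mathcal{F}$ then there is a countable $A\subseteq X$ with $A\#(\mathcal{F}\vee\mathcal{H})$. For a relation $\star$, $\mathbb{J}^\star(X)=\{\mathcal{F}\in\mathbb{F}(X):\mathcal{F}\star\mathcal{G}\text{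 for all }\mathcal{G}\in\mathbb{J}(X)\}$; $\mathbb{F}_1^{\bigtriangleup\diamondsuit}=(\mathbb{F}_1^{\bigtriangleup})^{\diamondsuit}$. $\ker(\mathbb{J})$ is the class of filters $\mathcal{F}$ (on a set $X$) such that for every set $Y$ and every $A\subseteq X\times Y$ with $A\#(\mathcal{F}\times Y)$, the filter $A\mathcal{F}$ generated by the sets $AF=\{y:\exists x\in F,(x,y)\in A\}$, $F\in\mathcal{F}$, is in $\mathbb{J}(Y)$. For a cardinal $\kappa$, $S_\kappa$ is the quotient of the disjoint union of $\kappa$ many mutually disjoint convergent sequences $(z_n^\xi)_{n\in\omega}$, $\xi<\kappa$ (with their limits), obtained by identifying all limit points to a single point $w$, with the quotient topology; $\mathcal{S}_\kappa$ is the neighborhood filter of $w$ in $S_\kappa$. $X^\omega$ is the set of sequences in $X$. *)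

(* Defs.v *)
From mathcomp Require Import all_boot all_classical.
From mathcomp Require Import topology wedge_sigT.

Set Implicit Arguments.
Unset Strict Implicit.
Unset Printing Implicit Defensive.

Local Open Scope classical_set_scope.

(* A set A is identified with its principal filter [globally A]; A meshes with
   F when [[set A] `#` F]. *)

Definition filter_class := forall X : Type, set (set_system X).

Definition filter_rel := forall X : Type, set_system X -> set_system X -> Prop.

Definition principal_filters : filter_class :=
  fun X => [set F | exists2 A : set X, A !=set0 & F = globally A].

Definition countably_based_filters : filter_class :=
  fun X => [set F | ProperFilter F /\
    exists2 B : set (set X), countable B & F = filter_from B id].

(* F \/ G; only meaningful when F `#` G. *)
Definition filter_join {X : Type} (F G : set_system X) : set_system X :=
  filter_from [set P | F P.1 /\ G P.2] (fun P => P.1 `&` P.2).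

Definition rel_triangle : filter_rel := fun X F H =>
  H `#` F ->
  exists2 L : set_system X, countably_based_filters L & filter_join F H `<=` L.

Definition rel_diamond : filter_rel := fun X F H =>
  H `#` F ->
  exists2 A : set X, countable A & [set A] `#` filter_join F H.

(* J^R *)
Definition polar (J : filter_class) (R : filter_rel) : filter_class :=
  fun X => [set F | ProperFilter F /\ forall G, J X G -> R X F G].

Definition F1_triangle : filter_class := polar principal_filters rel_triangle.

Definition F1_diamond : filter_class := polar principal_filters rel_diamond.

Definition F1_triangle_diamond : filter_class := polar F1_triangle rel_diamond.

Definition rel_image {X Y : Type} (A : set (X * Y)) (B : set X) : set Y :=
  [set y | exists2 x, B x & A (x, y)].

(* The sets [rel_image A B], B in F, are directed downwards, so their upward
   closure is the filter they generate. *)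
Definition image_filter {X Y : Type} (A : set (X * Y)) (F : set_system X) :
    set_system Y :=
  filter_from F (rel_image A).

Definition filter_ker (J : filter_class) : filter_class :=
  fun X => [set F | ProperFilter F /\
    forall (Y : Type) (A : set (X * Y)),
      [set A] `#` filter_prod F (globally [set: Y]) -> J Y (image_filter A F)].

Definition free_filter {X : Type} (F : set_system X) : Prop :=
  \bigcap_(A in F) A = set0.

Definition free_seq {X : Type} (x : nat -> X) : Prop := free_filter (x @ \oo).

Definition principal_seq {X : Type} (x : nat -> X) : Prop :=
  principal_filters (x @ \oo).

(* A convergent sequence with its limit is the one-point compactification of
   the discrete space nat, its limit being [None]. *)
Definition seq_fan (K : Type) : topologicalType :=
  wedge (fun _ : {classic K} => None : one_point_compactification nat).

Definition seq_fan_point {K : Type} (k : K) : seq_fan K :=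
  @wedge_lift {classic K} (fun=> one_point_compactification nat)
    (fun=> None) k None.

(* The points [seq_fan_point k] all coincide (see [seq_fan_nbhsE]); the
   intersection only avoids choosing an element of K, and is improper exactly
   when K is empty. *)
Definition seq_fan_nbhs (K : Type) : set_system (seq_fan K) :=
  \bigcap_(k : K) nbhs (seq_fan_point k).

Lemma seq_fan_nbhsE (K : Type) (k : K) :
  @seq_fan_nbhs K = nbhs (seq_fan_point k).
Proof.
apply/seteqP; split => [U /(_ k I) //|U Uk j _].
suff -> : seq_fan_point j = seq_fan_point k by [].
exact: (@wedge_liftE {classic K} (fun=> one_point_compactification nat)
  (fun=> None) k None j None).
Qed.

(* Main.v *)
Require Import Defs.
From mathcomp Require Import all_boot all_classical.
From mathcomp Require Import topology wedge_sigT.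
Set Implicit Arguments.
Unset Strict Implicit.
Unset Printing Implicit Defensive.
Local Open Scope classical_set_scope.

(** Write FrU for the class of filters [F1_triangle]; these are the filters of
    Frechet-Urysohn type: [H] is one of them exactly when every set meshing
    with [H] contains a sequence finer than [H] ([F1_triangleP]). Sequences
    belong to this class, and so do infima of sequences
    ([F1_triangle_seq_inf]), because a set meshing with an infimum of filters
    meshes with one of them.

    Everything revolves around condition (3), named [seq_selection] below:
    from any family of sequences whose infimum meshes with [F], countably many
    can be selected whose infimum still meshes with [F].

    The engine is [seq_selection_prod]: if [F] has this property, [H] is FrU
    and a relation [R] meshes with the product of [F] and [H], then a countable
    subset of [R] already does. To see this, consider all sequences in [R]
    whose second coordinates converge to [H], and project them to the first
    factor. Since [H] is FrU, the infimum of these projections meshes with [F];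
    the terms of countably many selected sequences form the countable set. This
    gives (6), as the neighborhood filter of the fan is an infimum of sequences,
    and it gives (1), as a countable subset of [R] projects to a countable set
    in the second factor.

    Conversely (3) is recovered from (1), (2) and (6) by tagging the terms of
    each sequence, so that a countable set of tagged points determines only
    countably many sequences.
    - For (1), a family indexed by [I] is lifted to [X * I], the terms of the
      sequence of index [a] being tagged by [a] ([ker_seq_selection]). This is
      where the kernel is needed: [F] itself only sees [X].
    - For (2), one countable set of [X] meshing with [F] and with the infimum
      is found first, and (1) is applied to the trace of [F] on it.
    - For (6), the branches of the fan are the sequences in [X] themselves, and
      the n-th term of a sequence is paired with the n-th point of the branch
      of that sequence ([fan_tight_seq_selection]). Repetitions in the family
      do no harm, so the number of branches does not depend on [I].

    Finally (4) implies (5) because an FrU filter is the infimum of the free or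
    principal sequences finer than it, and (5) contains (3) because sequences
    are FrU. *)

(** * Meshing, joins and products of filters *)

Lemma meets_set1 (X : Type) (A : set X) (F : set_system X) :
  [set A] `#` F <-> forall B, F B -> A `&` B !=set0.
Proof. by split=> [AF B FB|AF _ B -> FB]; apply: AF. Qed.

Lemma meets_join (X : Type) (C : set X) (F G : set_system X) :
  [set C] `#` filter_join F G <->
  forall A B, F A -> G B -> C `&` (A `&` B) !=set0.
Proof.
rewrite meets_set1; split=> CFG.
  by move=> A B FA GB; apply: CFG; exists (A, B).
move=> D [[A B] /= [FA GB] ABD]; have [c [Cc ABc]] := CFG _ _ FA GB.
by exists c; split=> //; exact: ABD.
Qed.

Lemma meets_prod (X Y : Type) (C : set (X * Y)) (F : set_system X)
    (G : set_system Y) :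
  [set C] `#` filter_prod F G <->
  forall A B, F A -> G B -> exists c, [/\ C c, A c.1 & B c.2].
Proof.
rewrite meets_set1; split=> CFG.
  move=> A B FA GB; have [|c [Cc [Ac Bc]]] := CFG (A `*` B); last by exists c.
  by exists (A, B).
move=> D [[A B] /= [FA GB] ABD]; have [c [Cc Ac Bc]] := CFG _ _ FA GB.
by exists c; split=> //; apply: ABD.
Qed.

Lemma filter_join_proper (X : Type) (F G : set_system X) :
  ProperFilter F -> ProperFilter G -> F `#` G -> ProperFilter (filter_join F G).
Proof.
move=> FF GG FG; apply: filter_from_proper; last first.
  by move=> [A B] /= [? ?]; apply: FG.
apply: filter_from_filter; first by exists (setT, setT); split; apply: filterT.
move=> [A B] [A' B'] /= [FA GB] [FA' GB']; exists (A `&` A', B `&` B').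
  by split; apply: filterI.
by move=> x /= [[? ?] [? ?]].
Qed.

(** The infimum of an empty family of filters is the improper filter, which
    meshes with nothing. *)
Lemma meets_bigcap_inhabited (I X : Type) (G : I -> set_system X)
    (F : set_system X) : Filter F ->
  (\bigcap_(a : I) G a) `#` F -> inhabited I.
Proof.
move=> FF GF; apply: contrapT => nI; have [|y []//] := GF set0 setT _ filterT.
by move=> a; exfalso; apply: nI.
Qed.

(** * Sequences *)

Lemma nearooE (X : Type) (s : nat -> X) (U : set X) :
  (s @ \oo) U <-> exists N, forall n, (N <= n)%N -> U (s n).
Proof. by split=> [[N _ sU]|[N sU]]; exists N. Qed.

Lemma meets_seq_subseq (X : Type) (s : nat -> X) (A : set X) :
  [set A] `#` (s @ \oo) ->
  exists m : nat -> nat, forall n, (n <= m n)%N /\ A (s (m n)).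
Proof.
move=> /meets_set1 As.
suff /choice[m mP] n : exists k, (n <= k)%N /\ A (s k) by exists m.
have [|y [Ay [k /= nk ky]]] := As [set s k | k in [set k | (n <= k)%N]].
  by apply/nearooE; exists n => k nk; exists k.
by exists k; rewrite ky.
Qed.

Lemma subseq_finer (X : Type) (s : nat -> X) (m : nat -> nat) :
  (forall n, n <= m n)%N -> (s @ \oo) `<=` ((s \o m) @ \oo).
Proof.
move=> nm U /nearooE[N sU]; apply/nearooE; exists N => n Nn.
exact/sU/(leq_trans Nn).
Qed.

Lemma seq_countably_based (X : Type) (s : nat -> X) :
  countably_based_filters (s @ \oo).
Proof.
split; first exact: fmap_proper_filter.
pose T n := [set s k | k in [set k | (n <= k)%N]].
exists (range T); first exact: (sub_countable (card_image_le _ _)).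
apply/seteqP; split=> U.
  move=> /nearooE[N sU]; exists (T N); first by exists N.
  by move=> _ [k Nk <-]; exact: sU.
move=> [_ [N _ <-] TU]; apply/nearooE; exists N => n Nn; apply: TU.
by exists n.
Qed.

(** For a sequence [s] which is not free, the constant sequence at a point
    common to all its tails is finer than [s]. *)
Lemma seq_free_or_principal_finer (X : Type) (s : nat -> X) :
  exists t : nat -> X, [/\ free_seq t \/ principal_seq t,
    (s @ \oo) `<=` (t @ \oo) & range t `<=` range s].
Proof.
have [fs|/eqP/set0P[x xs]] := pselect (free_seq s).
  by exists s; split=> //; left.
exists (fun=> x); split.
- right; exists [set x]; first by exists x.
  apply/seteqP; split=> U.
    by move=> /nearooE[N /(_ N (leqnn N)) Ux] _ ->.
  by move=> Ux; apply/nearooE; exists 0 => n _; exact: Ux.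
- by move=> U sU; apply/nearooE; exists 0 => n _; exact: xs.
- move=> _ [_ _ <-]; apply: xs; apply/nearooE; exists 0 => n _.
  by exists n.
Qed.

(** * Filters of Frechet-Urysohn type *)

(** Given a countably based filter finer than [H] and containing [A], with base
    [B], a sequence is obtained by picking its n-th term in [A] and in the
    first n members of [B]. *)
Lemma F1_triangleP (X : Type) (H : set_system X) : ProperFilter H ->
  F1_triangle H <-> forall A : set X, [set A] `#` H ->
    exists2 s : nat -> X, (forall n, A (s n)) & H `<=` (s @ \oo).
Proof.
move=> HH; split.
  move=> [_ HF] A /meets_set1 AH.
  have A0 : A !=set0 by have [x [Ax _]] := AH _ filterT; exists x.
  have [||L [LL [B /countable_injP[f finj] LB]] HL] := HF (globally A).
  - by exists A.
  - move=> C D AC HD; have [x [Ax Dx]] := AH _ HD; exists x; split=> //.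
    exact: AC.
  (* [f] injects [B] into nat, so [b] is the f b-th member of [B]; an index that
     is not a value of [f] imposes no condition. *)
  have LP n : L [set x | forall b, B b -> (f b < n)%N -> b x].
    elim: n => [|n IHn]; first by apply: filterS filterT.
    have [[b [Bb fb]]|nb] := pselect (exists b, B b /\ f b = n).
      have Lb : L b by rewrite LB; exists b.
      apply: filterS (filterI IHn Lb) => x [xn bx] b' Bb'.
      rewrite ltnS leq_eqVlt => /predU1P[fb'|]; last exact: xn.
      by suff -> : b' = b by []; apply: finj; rewrite ?inE// fb fb'.
    apply: filterS IHn => x xn b Bb.
    rewrite ltnS leq_eqVlt => /predU1P[fb|]; last exact: xn.
    by exfalso; apply: nb; exists b.
  have LA : L A.
    apply: HL; exists (setT, A) => /=; last by move=> ? [].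
    by split=> //; exact: filterT.
  have /choice[s sP] n : exists x, A x /\ forall b, B b -> (f b < n)%N -> b x.
    by have [x [? ?]] := filter_ex (filterI LA (LP n)); exists x.
  exists s; first by move=> n; have [] := sP n.
  move=> U HU; have : L U.
    by apply: HL; exists (U, A) => /=; [split|move=> ? []].
  rewrite LB => -[b Bb bU]; apply/nearooE; exists (f b).+1 => n fbn.
  by apply: bU; have [_] := sP n; apply.
move=> HS; split=> // _ [A A0 ->] AH.
have [|s As Hs] := HS A.
  by apply/meets_set1 => B HB; apply: AH.
exists (s @ \oo); first exact: seq_countably_based.
move=> P [[U V] /= [HU AV] UVP].
have /nearooE[N sU] := Hs _ HU; apply/nearooE; exists N => n Nn.
by apply: UVP; split; [exact: sU|apply: AV].
Qed.

(** A set meshing with an infimum of filters meshes with one of them, since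
    otherwise its complement lies in all of them; here it then contains a
    subsequence of one of the sequences. *)
Lemma F1_triangle_seq_inf (I X : Type) (x : I -> nat -> X) : inhabited I ->
  F1_triangle (\bigcap_(a : I) (x a @ \oo)).
Proof.
move=> [a0].
have HF : ProperFilter (\bigcap_(a : I) (x a @ \oo)).
  apply: Build_ProperFilter_ex.
    by move=> P /(_ a0 Logic.I)/filter_ex[y]; exists y.
  split.
  - by move=> a _; exact: filterT.
  - by move=> P Q PH QH a _; apply: filterI; [exact: PH|exact: QH].
  - by move=> P Q PQ PH a _; apply: filterS PQ _; exact: PH.
apply/F1_triangleP => A /meets_set1 AH.
have [a Aa] : exists a, [set A] `#` (x a @ \oo).
  apply: contrapT => /forallNP nA.
  have [|y [Ay]] := AH (~` A); last exact.
  move=> a _; apply: contrapT => nxa; apply: (nA a); apply/meets_set1 => B xB.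
  apply: contrapT => AB; apply: nxa; apply: filterS xB => z Bz Az.
  by apply: AB; exists z.
have [m mP] := meets_seq_subseq Aa; exists (x a \o m) => [n|U HU].
  by have [] := mP n.
by apply: subseq_finer (HU a _) => // n; have [] := mP n.
Qed.

Lemma F1_triangle_seq (X : Type) (s : nat -> X) : F1_triangle (s @ \oo).
Proof.
suff -> : (s @ \oo) = \bigcap_(_ : unit) (s @ \oo).
  exact/F1_triangle_seq_inf.
by apply/seteqP; split=> [U sU _ _|U /(_ tt Logic.I)].
Qed.

(** * Selecting countably many sequences *)

Definition seq_selection (X : Type) (F : set_system X) :=
  forall (I : Type) (x : I -> nat -> X),
    (\bigcap_(a : I) (x a @ \oo)) `#` F ->
    exists2 J : set I, countable J & (\bigcap_(a in J) (x a @ \oo)) `#` F.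

(** This is the central construction: [seq_selection F] is applied to the first
    coordinates of all the sequences in [R] whose second coordinates converge
    to [H]. *)
Lemma seq_selection_prod (X Y : Type) (F : set_system X) (H : set_system Y)
    (R : set (X * Y)) :
  ProperFilter F -> seq_selection F -> F1_triangle H ->
  [set R] `#` filter_prod F H ->
  exists2 C, countable C & C `<=` R /\ [set C] `#` filter_prod F H.
Proof.
move=> FF selF HT; have HH : ProperFilter H by case: HT.
move=> /meets_prod RFH.
pose I := {s : nat -> X * Y | (forall n, R (s n)) /\ H `<=` ((snd \o s) @ \oo)}.
have [|J cJ JF] := selF I (fun s n => (sval s n).1).
  move=> U A UI FA.
  (* As R meshes with F x H, the image of A under R meshes with H; a sequence
     converging to H in this image is lifted to R with first terms in A. *)
  have [|s sA Hs] := (F1_triangleP HH).1 HT (rel_image R A).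
    apply/meets_set1 => B HB; have [[x y] [/= Rxy Ax By]] := RFH _ _ FA HB.
    by exists y; split=> //; exists x.
  have /choice[t tP] n : exists x, A x /\ R (x, s n).
    by have [x] := sA n; exists x.
  pose r n := (t n, s n).
  have rI : (forall n, R (r n)) /\ H `<=` ((snd \o r) @ \oo).
    by split=> // n; have [] := tP n.
  have /nearooE[N /(_ N (leqnn N)) /= UN] := UI (exist _ r rI) Logic.I.
  by exists (t N); split=> //; have [] := tP N.
exists (\bigcup_(s in J) range (sval s)).
  apply: bigcup_countable => // s _.
  exact: sub_countable (card_image_le _ _) _.
split; first by move=> _ [s _ [n _ <-]]; have [+ _] := svalP s; apply.
apply/meets_prod => A B FA HB.
pose U := [set z | exists s n, [/\ J s, B (sval s n).2 & z = (sval s n).1]].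
have [|_ [[s [n [Js Bsn ->]]] As]] := JF U A _ FA; last first.
  by exists (sval s n); split=> //; exists s => //; exists n.
move=> s Js; have [_ /(_ _ HB)/nearooE[N sB]] := svalP s.
by apply/nearooE; exists N => n Nn; exists s, n; split=> //; exact: sB.
Qed.

(** * The kernel *)

(** The family is made disjoint in [X * I]: the image of [F] under the relation
    relating y to all (y, a) is generated by the products A x I, and it meshes
    with the infimum of the tagged sequences. A countable set meshing with
    their join involves countably many tags, and these are the selected
    indices. *)
Lemma ker_seq_selection (X : Type) (F : set_system X) :
  filter_ker F1_triangle_diamond F -> seq_selection F.
Proof.
move=> [FF kF] I x xF; have I0 := meets_bigcap_inhabited FF xF.
pose R : set (X * (X * I)) := [set p | p.2.1 = p.1].
pose H := \bigcap_(a : I) ((fun n => (x a n, a)) @ \oo).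
have [|_ /(_ H)] := kF _ R.
  apply/meets_prod => A B FA BT; have [y Ay] := filter_ex FA; have [a] := I0.
  by exists (y, (y, a)); split=> //; exact: BT.
case=> [||C cC /meets_join CH].
- exact: F1_triangle_seq_inf.
- move=> V P VH [A FA AB].
  have [|y [[a Va] Ay]] := xF [set y | exists a, V (y, a)] A _ FA.
    move=> a _; have /nearooE[N aV] := VH a Logic.I; apply/nearooE.
    by exists N => n Nn; exists a; exact: aV.
  by exists (y, a); split=> //; apply: AB; exists y.
exists (snd @` C); first exact: (sub_countable (card_image_le _ _)).
move=> U A UJ FA.
(* Away from the tags occurring in C the set below contains everything, which
   puts it in the infimum of the whole family. *)
have [||[y a] [Cya [[y' Ay' Ry] ya]]] := CH (rel_image R A)
    [set p | (snd @` C) p.2 -> U p.1]; last 1 first.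
- rewrite /R /= in Ry; exists y; rewrite Ry; split=> //; rewrite -Ry.
  by apply: ya; exists (y, a).
- by exists A.
- move=> a _; have [Ca|nCa] := pselect ((snd @` C) a).
    have /nearooE[N aU] := UJ a Ca; apply/nearooE.
    by exists N => n Nn _; exact: aU.
  by apply/nearooE; exists 0 => n _.
Qed.

Lemma image_filter_proper (X Y : Type) (F : set_system X) (R : set (X * Y)) :
  ProperFilter F -> [set R] `#` filter_prod F (globally setT) ->
  ProperFilter (image_filter R F).
Proof.
move=> FF /meets_prod RF; apply: filter_from_proper; last first.
  move=> A FA; have [//|[x y] [/= Rxy Ax _]] := RF A setT FA; by exists y, x.
apply: filter_from_filter; first by exists setT; exact: filterT.
move=> A B FA FB; exists (A `&` B); first exact: filterI.
by move=> y [x [Ax Bx] Rxy]; split; exists x.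
Qed.

Lemma seq_selection_ker (X : Type) (F : set_system X) : ProperFilter F ->
  seq_selection F -> filter_ker F1_triangle_diamond F.
Proof.
move=> FF selF; split=> // Y R RF; split; first exact: image_filter_proper.
move=> H HT HRF; have [|C cC [CR /meets_prod CFH]] :=
    @seq_selection_prod _ _ F H R FF selF HT.
  apply/meets_prod => A B FA HB.
  have [|y [By [x Ax Rxy]]] := HRF B (rel_image R A) HB; first by exists A.
  by exists (x, y).
exists (snd @` C); first exact: (sub_countable (card_image_le _ _)).
apply/meets_join => P B [A FA AP] HB.
have [[x y] [/= Cxy Ax By]] := CFH _ _ FA HB.
exists y; split; first by exists (x, y).
by split=> //; apply: AP; exists x => //; exact: CR.
Qed.

(** The diagonal of [X] is a relation under which the image of [F] is [F]. *)
Lemma filter_ker_sub (X : Type) (F : set_system X) (J : Defs.filter_class) :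
  filter_ker J F -> J X F.
Proof.
move=> [FF kF]; pose D : set (X * X) := [set p | p.1 = p.2].
suff <- : image_filter D F = F.
  apply: kF; apply/meets_prod => A B FA BT; have [x Ax] := filter_ex FA.
  by exists (x, x); split=> //; exact: BT.
apply/seteqP; split=> [P [A FA AP]|A FA].
  by apply: filterS FA => x Ax; apply: AP; exists x.
by exists A => // y [x Ax]; rewrite /D /= => <-.
Qed.

(** Images of the trace of [F] on [A] are images of [F] under relations
    restricted to [A]. *)
Lemma filter_ker_join (X : Type) (F : set_system X) (J : Defs.filter_class)
    (A : set X) :
  filter_ker J F -> [set A] `#` F -> filter_ker J (filter_join F (globally A)).
Proof.
move=> [FF kF] /meets_set1 AF; split.
  have [x [Ax _]] := AF _ filterT.
  apply: filter_join_proper => [|B C FB AC].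
    exact: globally_properfilter Ax.
  by have [y [Ay By]] := AF _ FB; exists y; split=> //; exact: AC.
move=> Y R /meets_prod RFA; pose R' : set (X * Y) := R `&` [set p | A p.1].
suff -> : image_filter R (filter_join F (globally A)) = image_filter R' F.
  apply: kF; apply/meets_prod => B C FB TC.
  have [||c [Rc [Bc Ac] Cc]] := RFA (B `&` A) C; last by exists c.
    by exists (B, A) => //=; split=> // ?.
  by [].
apply/seteqP; split=> P.
  move=> [D [[B C] /= [FB AC] BCD] DP]; exists B => // y [x Bx [Rxy Ax]].
  by apply: DP; exists x => //; apply: BCD; split=> //; exact: AC.
move=> [B FB BP]; exists (B `&` A); first by exists (B, A) => //=; split=> // ?.
by move=> y [x [Bx Ax] Rxy]; apply: BP; exists x.
Qed.

(** A countable set [A] meshing with the join of [F] and the infimum of the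
    sequences exists as that infimum is FrU. The trace of [F] on [A] then
    still meshes with the whole family, and selecting for this finer filter
    selects for [F]. *)
Lemma trace_ker_seq_selection (X : Type) (F : set_system X) :
  F1_triangle_diamond F ->
  (forall A : set X, countable A -> [set A] `#` F ->
     filter_ker F1_triangle_diamond (filter_join F (globally A))) ->
  seq_selection F.
Proof.
move=> [FF TF] kF I x xF; have I0 := meets_bigcap_inhabited FF xF.
have [//|A cA /meets_join AFx] := TF _ (F1_triangle_seq_inf x I0).
have AF : [set A] `#` F.
  apply/meets_set1 => B FB; have [|y [Ay [By _]]] := AFx B setT FB.
    by move=> a _; exact: filterT.
  by exists y.
have [|J cJ JFA] := ker_seq_selection (kF A cA AF) (x := x).
  move=> U D Ux [[B C] /= [FB AC] BCD]; have [y [Ay [By Uy]]] := AFx _ _ FB Ux.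
  by exists y; split=> //; apply: BCD; split=> //; exact: AC.
by exists J => // U B UJ FB; apply: JFA => //; exists (B, A) => //=.
Qed.

(** * Selecting filters of Frechet-Urysohn type *)

(** Each [G a] is the infimum of the free or principal sequences finer than it,
    since the complement of any set outside [G a] contains such a sequence. The
    selection is applied to all pairs of an index [a] and such a sequence for
    [G a]. *)
Lemma seq_selection_F1_triangle (X : Type) (F : set_system X) :
  ProperFilter F ->
  (forall (I : Type) (x : I -> nat -> X),
      (forall a, free_seq (x a) \/ principal_seq (x a)) ->
      (\bigcap_(a : I) (x a @ \oo)) `#` F ->
      exists2 J : set I, countable J & (\bigcap_(a in J) (x a @ \oo)) `#` F) ->
  forall (I : Type) (G : I -> set_system X),
      (forall a, F1_triangle (G a)) ->
      (\bigcap_(a : I) G a) `#` F ->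
      exists2 J : set I, countable J & (\bigcap_(a in J) G a) `#` F.
Proof.
move=> FF selF I G GT GF.
pose K := {p : I * (nat -> X) |
  (free_seq p.2 \/ principal_seq p.2) /\ G p.1 `<=` (p.2 @ \oo)}.
have [||J cJ JF] := selF K (fun p => (sval p).2).
- by move=> p; have [] := svalP p.
- move=> U A UK FA; apply: GF => // a _; apply: contrapT => nGU.
  have GF' : ProperFilter (G a) by have [] := GT a.
  have [|s sU Gs] := (F1_triangleP GF').1 (GT a) (~` U).
    apply/meets_set1 => B GB; apply: contrapT => UB; apply: nGU.
    by apply: filterS GB => x Bx; apply: contrapT => Ux; apply: UB; exists x.
  have [t [tfp st ts]] := seq_free_or_principal_finer s.
  have tK : (free_seq t \/ principal_seq t) /\ G a `<=` (t @ \oo).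
    by split=> //; exact: subset_trans st.
  have /nearooE[N /(_ N (leqnn N)) /= Ut] :=
    UK (exist _ (a, t) tK) Logic.I.
  have [|n _ tn] := ts (t N); first by exists N.
  by apply: (sU n); rewrite tn.
exists ((fun p => (sval p).1) @` J).
  exact: (sub_countable (card_image_le _ _)).
move=> U A UJ FA; apply: JF => // p Jp; have [_] := svalP p; apply.
by apply: UJ; exists p.
Qed.

(** * The sequential fan *)

Lemma nbhs_opc_natE (U : set (one_point_compactification nat)) :
  nbhs (None : one_point_compactification nat) U <->
  U None /\ ((Some : nat -> one_point_compactification nat) @ \oo) U.
Proof.
split.
  move=> [W [cW _] WU]; split; first by apply: WU; right.
  have /compact_near_coveringP/(_ _ \oo (fun n x => (x < n)%N)) := cW.
  case=> [x _|N _ NW].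
    exists ([set x], [set i | (x < i)%N]) => /=.
      split; last by exists x.+1.
      by apply: open_nbhs_nbhs; split=> //; exact: discrete_open.
    by move=> [y i] [/= -> ].
  apply/nearooE; exists N => n Nn; apply: WU; left; exists n => // Wn.
  by have := NW _ Nn _ Wn; rewrite ltnn.
move=> [UN /nearooE[N NU]]; exists [set n | (n < N)%N].
  split; last exact: discrete_closed.
  by apply: finite_compact; exact: finite_II.
move=> _ [[n /= /negP + <-]|->//]; rewrite -leqNgt; exact: NU.
Qed.

Definition seq_fan_lift (K : Type) (k : K) :
    one_point_compactification nat -> seq_fan K :=
  @wedge_lift {classic K} (fun=> one_point_compactification nat)
    (fun=> None) k.

Lemma seq_fan_nbhs_lift (K : Type) (V : set (seq_fan K)) : inhabited K ->
  @seq_fan_nbhs K V <-> forall k : K,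
    V (seq_fan_lift k None) /\ ((fun n => seq_fan_lift k (Some n)) @ \oo) V.
Proof.
move=> [k0]; rewrite (seq_fan_nbhsE k0) /seq_fan_point wedge_point_nbhs.
split=> [VP k|VP k _]; last by apply/nbhs_opc_natE; exact: VP.
by have /nbhs_opc_natE := VP k Logic.I.
Qed.

(** The neighborhood filter of the fan is the infimum of its branches, one for
    each [Some k], and of the constant sequence at the vertex, for [None]. *)
Lemma seq_fan_nbhs_F1_triangle (K : Type) : inhabited K ->
  F1_triangle (@seq_fan_nbhs K).
Proof.
move=> K0; have [k0] := K0.
pose x (a : option K) n :=
  if a is Some k then seq_fan_lift k (Some n) else seq_fan_lift k0 None.
suff -> : @seq_fan_nbhs K = \bigcap_(a : option K) (x a @ \oo).
  by apply: F1_triangle_seq_inf; constructor; exact: None.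
apply/seteqP; split=> V.
  move=> /(seq_fan_nbhs_lift V K0) VP [k|] _; first by have [] := VP k.
  by apply/nearooE; exists 0 => n _; have [] := VP k0.
move=> VP; apply/(seq_fan_nbhs_lift V K0) => k; split; last first.
  exact: VP (Some k) Logic.I.
have /nearooE[N /(_ N (leqnn N))] := VP None Logic.I.
by congr (V _); exact: (@wedge_liftE {classic K}
  (fun=> one_point_compactification nat) (fun=> None) k None k0 None).
Qed.

Lemma seq_selection_F1_diamond (X Y : Type) (F : set_system X)
    (H : set_system Y) : ProperFilter F -> seq_selection F ->
  F1_triangle H -> F1_diamond (filter_prod F H).
Proof.
move=> FF selF HT; have HH : ProperFilter H by case: HT.
split; first exact: filter_prod_proper.
move=> _ [R R0 ->] RFH; have [|C cC [CR /meets_set1 CFH]] :=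
    seq_selection_prod FF selF HT (R := R).
  by apply/meets_set1 => B FHB; apply: RFH.
exists C => //; apply/meets_join => D B FHD RB; have [c [Cc Dc]] := CFH _ FHD.
by exists c; split=> //; split=> //; exact/RB/CR.
Qed.

(** Here the relation consists of the points pairing the n-th term of a
    sequence [x a] of the family with the n-th point of the branch [x a] of the
    fan. Choosing such an index [a] for each point of a countable set that
    meshes with the trace of the product filter gives the selection. *)
Lemma fan_tight_seq_selection (X : Type) (F : set_system X) : ProperFilter F ->
  F1_diamond (filter_prod F (@seq_fan_nbhs (nat -> X))) -> seq_selection F.
Proof.
move=> FF [_ tF] I x xF.
have [x0 _] := filter_ex (@filterT _ F _).
pose K : Type := nat -> X.
have K0 : inhabited K by exists => _; exact: x0.
pose R : set (X * seq_fan K) :=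
  [set p | exists a n, p = (x a n, seq_fan_lift (x a) (Some n))].
have RF : [set R] `#` filter_prod F (@seq_fan_nbhs K).
  apply/meets_prod => A V FA /(seq_fan_nbhs_lift V K0) VP.
  have [|_ [[a [n [-> Vn]]] An]] :=
      xF [set z | exists a n, z = x a n /\ V (seq_fan_lift (x a) (Some n))]
         A _ FA.
    move=> a _; have [_ /nearooE[N NV]] := VP (x a).
    by apply/nearooE; exists N => n Nn; exists a, n; split=> //; exact: NV.
  by exists (x a n, seq_fan_lift (x a) (Some n)); split=> //; exists a, n.
have [||C cC /meets_join CFR] := tF (globally R).
- exists R => //.
  have [||c [Rc _ _]] := (meets_prod _ _ _).1 RF setT setT; last by exists c.
  + exact: filterT.
  + by move=> k _; exact: filterT.
- move=> B D RB FD; have [c [Rc Dc]] := (meets_set1 _ _).1 RF _ FD.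
  by exists c; split=> //; exact: RB.
have [a0] := meets_bigcap_inhabited FF xF.
have /choice[al alP] (c : X * seq_fan K) : exists a, R c ->
    exists n, c = (x a n, seq_fan_lift (x a) (Some n)).
  by have [[a an]|nR] := pselect (R c); [exists a|exists a0].
exists (al @` C); first exact: (sub_countable (card_image_le _ _)).
move=> U A UJ FA.
(* The neighborhood V of the vertex is cut by U on the branches of the selected
   sequences and contains the other branches. *)
pose f (k : {classic K}) (p : one_point_compactification nat) : Prop :=
  if p is Some n then (exists2 a, (al @` C) a & x a = k) -> U (k n) else True.
pose V : set (seq_fan K) := wedge_fun f.
have VE k p : V (seq_fan_lift k p) = f k p by exact: wedge_lift_funE.
have FV : filter_prod F (@seq_fan_nbhs K) (A `*` V).
  exists (A, V) => //; split=> //; apply/(seq_fan_nbhs_lift V K0) => k.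
  split; first by rewrite VE.
  have [[a Ja xa]|nk] := pselect (exists2 a, (al @` C) a & x a = k).
    have /nearooE[N NU] := UJ a Ja; apply/nearooE; exists N => n Nn.
    by rewrite /= VE => _ /=; rewrite -xa; exact: NU.
  by apply/nearooE; exists 0 => n _; rewrite /= VE.
have [|c [Cc [[Ac Vc] Rc]]] := CFR _ R FV; first by move=> ?.
have [n cn] := alP c Rc; exists c.1; split=> //.
rewrite cn /= VE in Vc; rewrite cn; apply: Vc.
by exists (al c) => //; exists c.
Qed.

Theorem theorem37 (X : Type) (F : set_system X) (FF : ProperFilter F) :
  [<->
    (* 1 *)
    filter_ker F1_triangle_diamond F;
    (* 2 *)
    F1_triangle_diamond F /\
    (forall A : set X, countable A -> [set A] `#` F ->
       filter_ker F1_triangle_diamond (filter_join F (globally A)));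
    (* 3 *)
    forall (I : Type) (x : I -> nat -> X),
      (\bigcap_(a : I) (x a @ \oo)) `#` F ->
      exists2 J : set I, countable J & (\bigcap_(a in J) (x a @ \oo)) `#` F;
    (* 4 *)
    forall (I : Type) (x : I -> nat -> X),
      (forall a, free_seq (x a) \/ principal_seq (x a)) ->
      (\bigcap_(a : I) (x a @ \oo)) `#` F ->
      exists2 J : set I, countable J & (\bigcap_(a in J) (x a @ \oo)) `#` F;
    (* 5 *)
    forall (I : Type) (G : I -> set_system X),
      (forall a, F1_triangle (G a)) ->
      (\bigcap_(a : I) G a) `#` F ->
      exists2 J : set I, countable J & (\bigcap_(a in J) G a) `#` F;
    (* 6 *)
    F1_diamond (filter_prod F (@seq_fan_nbhs (nat -> X)))].
Proof.
tfae.
- move=> kF; split; first exact: filter_ker_sub.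
  by move=> A _; exact: filter_ker_join.
- by move=> [TF kF]; exact: trace_ker_seq_selection.
- by move=> selF I x _; exact: selF.
- exact: seq_selection_F1_triangle.
- move=> selF; apply: seq_selection_F1_diamond.
    by move=> I x; apply: selF => a; exact: F1_triangle_seq.
  have [x0 _] := filter_ex (@filterT _ F _).
  by apply: seq_fan_nbhs_F1_triangle; exists => _; exact: x0.
- by move=> /fan_tight_seq_selection selF; exact: seq_selection_ker.
Qed.
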